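(* The following infinite procedure gives a complete set $\{w_1,w_2,\ldots\}$ of free generators of the algebra of invariants $(K\langle x,y\rangle)^{SL_2(K)}$. Set $w_1=[x,y]=xy-yx$. If all free generators $w_1,w_2,\ldots,w_k$ of degree $\leq 2n$ ($n\ge 1$) have already been constructed, form all $c_{n+1}$ products $w_{i_1}\cdots w_{i_s}$ of degree $2n$, number them as $\omega_j$, $j=1,\ldots,c_{n+1}$, and add to the system of generators the $c_{n+1}$ elements \[ w_{k+j}=x\omega_jy-y\omega_jx,\qquad j=1,\ldots,c_{n+1}. \]
   Context: $K$ is a field of characteristic $0$ and $K\langle x,y\rangle$ is the free unitary associative $K$-algebra on $x,y$, graded by degree. $SL_2(K)$ acts naturally on $Kx\oplus Ky$ and diagonally on $K\langle x,y\rangle$ by algebra automorphisms, and $(K\langle x,y\rangle)^{SL_2(K)}$ is the subalgebra of elements fixed by $SL_2(K)$. $c_{n}$ denotes the $n$-th Catalan number, in the indexing where $c_n$ is the number of ways to distribute parentheses in the sum $1+1+\cdots+1$ of $n$ units, i.e. $c_{n+1}=\frac{1}{n+1}\binom{2n}{n}$. The products $w_{i_1}\cdots w_{i_s}$ are all (noncommutative) products, with $s\ge1$ and repetitions allowed, of the constructed elements having total degree $2n$ in $x,y$. ''Complete set of free generators'' means that the elements generate the algebra and are free generators of it as a unitary free associative algebra. *)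

(* Defs.v *)
From HB Require Import structures.
From mathcomp Require Import all_boot all_order all_algebra finmap.
From mathcomp Require Import monalg.

Set Implicit Arguments.
Unset Strict Implicit.
Unset Printing Implicit Defensive.

Import GRing.Theory.

Local Open Scope ring_scope.

(* [freealg K I] is the free unitary associative algebra K<X_i | i in I>: the
   monoid algebra of the free monoid on I. *)
Notation freealg K I := {malg K[{fmonom I}]}.

Definition fvar (K : fieldType) (I : choiceType) (i : I) : freealg K I :=
  << fmu i >>.

(* The unital algebra homomorphism K<X_i | i in I> -> A mapping X_i to w i. *)
Definition nceval (K : fieldType) (I : choiceType) (A : lalgType K)
    (w : I -> A) (p : freealg K I) : A :=
  \sum_(m <- msupp p) p@_m *: \prod_(i <- (m : seq I)) w i.

(* [mmeasure] is one more than the largest length of a monomial in the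
   support, and 0 for the zero element; hence ncdeg 0 = 0. *)
Definition ncdeg (K : fieldType) (I : choiceType) (p : freealg K I) : nat :=
  (mmeasure (@fdeg I) p).-1.

Definition ncx (K : fieldType) : freealg K 'I_2 := fvar K (0 : 'I_2).
Definition ncy (K : fieldType) : freealg K 'I_2 := fvar K (1 : 'I_2).

(* Matrices act on the coordinate columns of Kx + Ky, that is,
   x |-> g_00 x + g_10 y and y |-> g_01 x + g_11 y, and this is extended to an
   algebra endomorphism of K<x,y>. *)
Definition mxact (K : fieldType) (g : 'M[K]_2) :
    freealg K 'I_2 -> freealg K 'I_2 :=
  nceval (fun i => \sum_(j < 2) g j i *: fvar K j).

Definition SL2_invariant (K : fieldType) (f : freealg K 'I_2) : Prop :=
  forall g : 'M[K]_2, \det g = 1 -> mxact g f = f.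

(* B is exactly the set of noncommutative polynomials in the w i. *)
Definition generates (K : fieldType) (I : choiceType) (A : lalgType K)
    (w : I -> A) (B : A -> Prop) : Prop :=
  forall f, B f <-> exists p : freealg K I, nceval w p = f.

Definition freely_independent (K : fieldType) (I : choiceType) (A : lalgType K)
    (w : I -> A) : Prop :=
  injective (nceval (K := K) w).

Definition complete_set_of_free_generators (K : fieldType) (I : choiceType)
    (A : lalgType K) (w : I -> A) (B : A -> Prop) : Prop :=
  generates w B /\ freely_independent w.

(* c_n counts the parenthesizations of a sum of n units, so that
   c_{n+1} = binom(2n, n) / (n+1); the division is exact, and c_0 = 0. *)
Definition catalan (n : nat) : nat :=
  if n is m.+1 then ('C(2 * m, m) %/ m.+1)%N else 0%N.

Definition gen_prod (K : fieldType) (w : nat -> freealg K 'I_2) (s : seq nat) :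
  freealg K 'I_2 := \prod_(i <- s) w i.

(* A run of the procedure, with generators indexed from 0.  [k n] is the number
   of generators present when the products of degree 2n are formed; [om n]
   numbers these products, each product w_{i_1} ... w_{i_s} being represented
   by its list of indices [:: i_1; ...; i_s].  The numbering is arbitrary, and
   the number of products is not prescribed. *)
Record procedure (K : fieldType) (w : nat -> freealg K 'I_2) (k : nat -> nat)
    (om : nat -> seq (seq nat)) : Prop := Procedure {
  proc_first : w 0%N = ncx K * ncy K - ncy K * ncx K;
  proc_k1 : k 1%N = 1%N;
  proc_uniq : forall n, (1 <= n)%N -> uniq (om n);
  proc_products : forall n, (1 <= n)%N -> forall s : seq nat,
    (s \in om n) = [&& s != [::], all (fun i => (i < k n)%N) s
                     & ncdeg (gen_prod w s) == (2 * n)%N];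
  proc_new : forall n, (1 <= n)%N -> forall j, (j < size (om n))%N ->
    let omega := gen_prod w (nth [::] (om n) j) in
    w (k n + j)%N = ncx K * omega * ncy K - ncy K * omega * ncx K;
  proc_kS : forall n, (1 <= n)%N -> k n.+1 = (k n + size (om n))%N
}.

(* Main.v *)
Require Import Defs.
From HB Require Import structures.
From mathcomp Require Import all_boot all_order all_algebra finmap.
From mathcomp Require Import monalg.
From mathcomp Require Import zify.

Set Implicit Arguments.
Unset Strict Implicit.
Unset Printing Implicit Defensive.

Import GRing.Theory.

Local Open Scope ring_scope.

(** The proof compares leading words with Dyck words, reading x as an up-step and
    y as a down-step and ordering words of equal length lexicographically with x
    above y.

    If f is homogeneous with leading word d and leading coefficient 1, then
    x f y - y f x is homogeneous with leading word x d y ([lead_bracket]), and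
    leading words of products are concatenated ([leadM]).  So each generator has
    as leading word a prime Dyck word x e y, where e is the leading word of the
    product it is built from, and the product with list of indices s has as
    leading word the concatenation of the corresponding prime Dyck words.  As
    every Dyck word is in a unique way a concatenation of words x e y with e a
    Dyck word, this is a bijection between the lists of indices and the Dyck
    words ([prod_word_inj], [prod_word_surj]).  It turns degrees into lengths,
    which gives the generators of degree at most 2n and, by counting Dyck words
    with the reflection principle ([card_dwords]), the number of products.

    Distinct leading words make the products linearly independent, which is
    freeness ([lead_linear_inj]).  The generators are invariant because
    x f y - y f x is multiplied by the determinant when f is invariant
    ([invariant_bracket]).  That they generate all invariants comes down to the
    fact that an invariant with no Dyck word in its support is zero
    ([invariant_eq0]), since the Dyck coefficients of an arbitrary invariant can
    be cancelled by products, from the largest word downwards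
    ([lead_linear_span]).

    That fact is a statement about vectors of weight zero killed by
    Delta = U - 1, where U is the substitution fixing x and sending y to x + y.
    It is proved for vectors of weight -h killed by the power h + 1 of Delta and
    with no word in their support that is a nonnegative path from height h to 0
    ([highest_weight_eq0]): splitting off the first letter raises or lowers h by
    one, like the first step of a path. *)

(** * Dyck words *)

Local Notation word := (seq 'I_2).

Lemma letterP (i : 'I_2) : (i = 0) + (i = 1).
Proof.
case: i => -[|[|i]] //= lt_i; [left | right]; exact: val_inj.
Qed.

(** The letter [0] (the variable x) is an up-step and the letter [1] (the
    variable y) is a down-step: [dyck h u] says that [u] is a path from height
    [h] to height [0] that stays at height at least [0], so that [dyck 0] is
    the set of Dyck words. *)
Fixpoint dyck (h : nat) (u : word) : bool :=
  if u is i :: u' then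
    if i == 0 then dyck h.+1 u' else if h is h'.+1 then dyck h' u' else false
  else h == 0%N.

Lemma dyck_cat h k (u v : word) : dyck h u -> dyck (h + k) (u ++ v) = dyck k v.
Proof.
elim: u h => [|i u IH] h /=; first by move=> /eqP ->.
case: (letterP i) => -> /=; first by move=> /IH; rewrite addSn.
by case: h => // h /IH; rewrite addSn.
Qed.

Lemma dyck_size_odd h (u : word) : dyck h u -> odd (size u) = odd h.
Proof.
elim: u h => [|i u IH] h /=; first by move=> /eqP ->.
case: (letterP i) => -> /=; first by move=> /IH ->; rewrite /= negbK.
by case: h => // h /IH ->.
Qed.

Lemma dyck_flatten (us : seq word) : all (dyck 0) us -> dyck 0 (flatten us).
Proof. by elim: us => //= u us IH /andP[du /IH]; rewrite (@dyck_cat 0 0). Qed.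

(** The path is cut at its first step below its starting height.  Applied to
    the tail of a nonempty Dyck word this is the decomposition x e y v, with
    [e] and [v] Dyck words, that mirrors the shape of the generators. *)
Lemma first_return h (u : word) : dyck h.+1 u ->
  exists e v, [/\ u = e ++ 1 :: v, dyck 0 e & dyck h v].
Proof.
have [n] := ubnP (size u); elim: n => // n IH in h u *.
case: u => [|i u] //=; rewrite ltnS => lt_u.
case: (letterP i) => -> /= du; last by exists [::], u.
have [e1 [v1 [def_u de1 dv1]]] := IH _ _ lt_u du.
have lt_v1 : (size v1 < n)%N.
  by move: lt_u; rewrite def_u size_cat /=; lia.
have [e2 [v2 [def_v1 de2 dv2]]] := IH _ _ lt_v1 dv1.
exists (0 :: e1 ++ 1 :: e2), v2; split=> //=.
  by rewrite def_u def_v1 -catA.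
by rewrite (@dyck_cat 0 1).
Qed.

Lemma first_return_uniq h (e e' v v' : word) : dyck h e -> dyck h e' ->
  e ++ 1 :: v = e' ++ 1 :: v' -> e = e' /\ v = v'.
Proof.
elim: e h e' => [|i e IH] h [|i' e'] /=.
- by move=> _ _ [].
- by move=> /eqP -> + [def_i _]; rewrite -def_i.
- by move=> du /eqP h0 [def_i _]; rewrite def_i h0 in du.
move=> de de' [def_i]; rewrite -def_i in de' *.
move: de de'; case: (letterP i) => -> /=.
  by move=> de de' /(IH _ _ de de')[-> ->].
by case: h => // h de de' /(IH _ _ de de')[-> ->].
Qed.

(** An enumeration of the words of length [n] that satisfy [dyck h]. *)
Fixpoint dwords (n h : nat) : seq word :=
  if n is n'.+1 then
    map (cons 0) (dwords n' h.+1) ++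
    (if h is h'.+1 then map (cons 1) (dwords n' h') else [::])
  else if h is 0%N then [:: [::]] else [::].

Lemma mem_cons_map (i : 'I_2) (us : seq word) u :
  (u \in map (cons i) us) = if u is j :: u' then (i == j) && (u' \in us) else false.
Proof.
case: u => [|j u]; first by apply/negbTE/negP => /mapP[].
have [->|ne] := eqVneq i j; first by rewrite mem_map // => u1 u2 [].
by apply/negbTE/negP => /mapP[u' _ [def_j]]; rewrite def_j eqxx in ne.
Qed.

Lemma mem_dwords n h u : (u \in dwords n h) = (size u == n) && dyck h u.
Proof.
elim: n h u => [|n IH] h [|i u] //=.
- by case: h.
- by case: h.
- by rewrite mem_cat !mem_cons_map; case: h => //= h; rewrite mem_cons_map.
rewrite mem_cat mem_cons_map IH eqSS.
case: h => [|h]; case: (letterP i) => -> /=; rewrite ?andbF ?orbF ?mem_cons_map ?IH ?orbF //=.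
Qed.

Lemma uniq_dwords n h : uniq (dwords n h).
Proof.
elim: n h => [|n IH] h /=; first by case: h.
have inj_cons (i : 'I_2) : injective (cons i) by move=> u1 u2 [].
rewrite cat_uniq map_inj_uniq // IH /=; case: h => //= h.
rewrite map_inj_uniq // IH andbT; apply/hasPn => u /mapP[u' _ ->].
by rewrite mem_cons_map.
Qed.

(** The reflection principle, n = h + 2j + 2 being the number of steps: the
    paths of length [n] from [h] to [0] that go below [0] are as many as all
    the paths with [j] up-steps.  It is proved here through the common
    recurrence of both sides. *)
Lemma card_dwords n h j : (n = h + 2 * j.+1)%N ->
  (size (dwords n h) + 'C(n, j))%N = 'C(n, j.+1).
Proof.
elim: n h j => [|n IH] h j /=; first by lia.
have small m k : (m = k)%N -> size (dwords m k) = 1%N.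
  move=> ->; elim: k => //= k; rewrite size_cat !size_map => ->.
  suff -> : dwords k k.+2 = [::] by [].
  have: (k < k.+2)%N by []; move: k.+2 => l.
  elim: k l => [|k IHk] [|l] //= lt_kl.
  by rewrite !IHk //; lia.
move=> def_n; rewrite size_cat size_map !binS.
case: j def_n => [|j] def_n.
  rewrite !bin0 bin1 small; last by lia.
  case: h def_n => [|h] def_n; first by rewrite /= addn0; lia.
  rewrite size_map; have := IH h 0%N; rewrite bin0 bin1 => IHh.
  have {IHh} := IHh _; lia.
have := IH h.+1 j; rewrite !binS; case: h def_n => [|h] def_n /=.
  have -> : 'C(n, j.+2) = 'C(n, j.+1).
    by rewrite -[RHS]bin_sub; [congr binomial; lia | lia].
  by lia.
have := IH h j.+1; rewrite size_map; lia.
Qed.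

Lemma size_dyck_words n : size (dwords (2 * n) 0) = catalan n.+1.
Proof.
rewrite /catalan; case: n => [|n]; first by rewrite muln0 bin0.
have := @card_dwords (2 * n.+1) 0 n erefl.
have := mul_bin_left (2 * n.+1) n.
set c := 'C(_, n); set d := 'C(_, n.+1); set s := size _ => e1 e2.
have -> : d = (s * n.+2)%N by nia.
by rewrite mulnK.
Qed.

(** An injective rank of words which, on words of a given length, increases
    along the lexicographic order with x above y: it is the number with binary
    digits [1] followed by the digits [1] for x and [0] for y. *)
Fixpoint code (u : word) : nat :=
  if u is i :: u' then (code u' + 2 ^ size u' * (1 + (i == 0%R)))%N else 1%N.

Lemma code_bounds u : (2 ^ size u <= code u < 2 ^ (size u).+1)%N.
Proof.
elim: u => //= i u; rewrite !expnS; case: (letterP i) => -> /=; lia.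
Qed.

Lemma code_inj : injective code.
Proof.
move=> u v; have eq_size : code u = code v -> size u = size v.
  move=> e; have := code_bounds u; have := code_bounds v; rewrite e.
  have [lt|lt|//] := ltngtP (size u) (size v).
    by have := @leq_pexp2l 2 _ _ isT lt; lia.
  by have := @leq_pexp2l 2 _ _ isT lt; lia.
move=> e; move: eq_size => /(_ e) s_uv; move: s_uv e.
elim: u v => [|i u IH] [|j v] //= [eq_s]; rewrite eq_s => e.
have := code_bounds u; have := code_bounds v; rewrite eq_s !expnS => b1 b2.
have eq_ij : i = j.
  by move: e; case: (letterP i) => ->; case: (letterP j) => -> //=; lia.
by rewrite eq_ij (IH v) //; move: e; rewrite eq_ij; lia.
Qed.

Lemma code_cat u v : (code (u ++ v) + 2 ^ size v = code u * 2 ^ size v + code v)%N.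
Proof.
elim: u => [|i u IH] /=; first by lia.
by rewrite size_cat expnD; nia.
Qed.

Lemma code_cat_le u u' v v' : size v = size v' ->
  (code u <= code u')%N -> (code v <= code v')%N ->
  (code (u ++ v) <= code (u' ++ v'))%N.
Proof.
move=> eq_s le_u le_v; have := code_cat u v; have := code_cat u' v'.
by rewrite eq_s => e1 e2; nia.
Qed.

Lemma code_yx u v : size u = size v -> (code (1%R :: u) <= code (0%R :: v))%N.
Proof.
move=> eq_s /=; have := code_bounds u; have := code_bounds v.
by rewrite eq_s !expnS /=; lia.
Qed.

(** * Evaluations and coefficients in free algebras *)

Section Nceval.
Variables (K : fieldType) (I : choiceType) (A : lalgType K) (w : I -> A).

Definition wordval (m : fmonom I) : A := \prod_(i <- (m : seq I)) w i.

Lemma ncevalE : nceval w =1 mmap (in_alg A) wordval.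
Proof. by move=> p; apply: eq_bigr => m _; rewrite mulr_algl. Qed.

Lemma wordval_morph : mmorphism wordval.
Proof.
by split=> [m n|]; rewrite /wordval ?fm1 ?big_nil // fmM big_cat.
Qed.

Lemma nceval_is_additive : additive (nceval w).
Proof. by move=> p q; rewrite !ncevalE raddfB. Qed.

Lemma ncevalZ c p : nceval w (c *: p) = c *: nceval w p.
Proof.
rewrite /nceval [RHS]scaler_sumr.
rewrite (big_fset_incl _ (msuppZ_le c p)) /= => [|m _ /mcoeff_outdom ->].
  by apply: eq_bigr => m _; rewrite mcoeffZ scalerA.
by rewrite scale0r.
Qed.

Lemma ncevalU c m : nceval w << c *g m >> = c *: wordval m.
Proof. by rewrite ncevalE mmapU mulr_algl. Qed.

End Nceval.

HB.instance Definition _ (K : fieldType) (I : choiceType) (A : lalgType K)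
    (w : I -> A) :=
  GRing.isAdditive.Build (freealg K I) A (nceval w) (nceval_is_additive w).
HB.instance Definition _ (K : fieldType) (I : choiceType) (A : lalgType K)
    (w : I -> A) :=
  GRing.isScalable.Build K (freealg K I) A *:%R (nceval w) (ncevalZ w).

Section Mul.
Variables (K : fieldType) (I J : choiceType).

(** The coefficients commute with the words, so that an evaluation with values
    in a free algebra is multiplicative. *)
Lemma malg_scaleAr c (f g : freealg K I) : c *: (f * g) = f * (c *: g).
Proof.
apply/malgP => m; rewrite (mcoeffZ c (f * g) m) [in LHS]mcoeffMl.
rewrite (mcoeffMlw _ (fsubset_refl _) (msuppZ_le c g)) mulr_sumr.
apply: eq_bigr => m1 _; rewrite mulr_sumr; apply: eq_bigr => m2 _.
by rewrite mcoeffZ mulrnAr mulrCA.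
Qed.

Lemma nceval_is_multiplicative (w : J -> freealg K I) :
  multiplicative (nceval w).
Proof.
have [wM w1] := wordval_morph w; split=> [p q|].
  rewrite malgME raddf_sum [X in _ = X * _]/nceval mulr_suml.
  apply: eq_bigr => m _; rewrite raddf_sum /= [X in _ = _ * X]/nceval mulr_sumr.
  apply: eq_bigr => n _; rewrite ncevalU wM -scalerAl -malg_scaleAr scalerA.
  exact: erefl.
have -> : (1 : freealg K J) = << 1 *g mone >> by [].
by rewrite ncevalU w1 scale1r.
Qed.
End Mul.

HB.instance Definition _ (K : fieldType) (I J : choiceType)
    (w : J -> freealg K I) :=
  GRing.isMultiplicative.Build (freealg K J) (freealg K I) (nceval w)
    (nceval_is_multiplicative w).

Section Coef.
Variables (K : fieldType) (I : choiceType).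
Implicit Types (f g : freealg K I) (u v : seq I).

(** The coefficient, indexed by plain sequences of letters. *)
Definition wcoef f u : K := f@_(FMonom u).

Lemma wcoefP f g : wcoef f =1 wcoef g -> f = g.
Proof. by move=> e; apply/malgP => -[u]; apply: e. Qed.

Lemma wcoefD f g u : wcoef (f + g) u = wcoef f u + wcoef g u.
Proof. exact: mcoeffD. Qed.
Lemma wcoefB f g u : wcoef (f - g) u = wcoef f u - wcoef g u.
Proof. exact: mcoeffB. Qed.
Lemma wcoefZ c f u : wcoef (c *: f) u = c * wcoef f u.
Proof. exact: mcoeffZ. Qed.
Lemma wcoef0 u : wcoef 0 u = 0.
Proof. exact: mcoeff0. Qed.
Lemma wcoef_sum (T : Type) (r : seq T) (F : T -> freealg K I) u :
  wcoef (\sum_(t <- r) F t) u = \sum_(t <- r) wcoef (F t) u.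
Proof. exact: (raddf_sum (mcoeff (FMonom u))). Qed.
Lemma wcoefU c v u : wcoef << c *g FMonom v >> u = c *+ (v == u).
Proof. by rewrite /wcoef mcoeffU -[FMonom v == _]val_eqE. Qed.

Lemma wcoef_supp f u : (wcoef f u != 0) = (FMonom u \in msupp f).
Proof. exact: mcoeff_neq0. Qed.

Lemma wcoefM_neq0 f g u : wcoef (f * g) u != 0 ->
  exists u1 u2, [/\ u = u1 ++ u2, wcoef f u1 != 0 & wcoef g u2 != 0].
Proof.
rewrite wcoef_supp => /msuppM_le[[u1] [[u2] [f1 g2 /(congr1 (@fmonom_val I))]]].
by rewrite fmM /= => ->; exists u1, u2; rewrite !wcoef_supp.
Qed.

(** When the left factor is homogeneous of degree [n], a word splits in only
    one way into a prefix of length [n] and a suffix. *)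
Lemma wcoefM_cat n f g u v : (forall u', wcoef f u' != 0 -> size u' = n) ->
  size u = n -> wcoef (f * g) (u ++ v) = wcoef f u * wcoef g v.
Proof.
move=> hom_f size_u.
pose E1 : {fset fmonom I} := (FMonom u |` msupp f)%fset.
pose E2 : {fset fmonom I} := (FMonom v |` msupp g)%fset.
rewrite /wcoef (@mcoeffMlw _ _ E1 E2) ?fsubsetUr //.
rewrite (big_fsetD1 (FMonom u)) ?fset1U1 //= [X in _ + X = _]big_seq [X in _ + X = _]big1 ?addr0.
  rewrite (big_fsetD1 (FMonom v)) ?fset1U1 //= [X in _ + X = _]big_seq [X in _ + X = _]big1 ?addr0.
    by rewrite -[mmul _ _ == _]val_eqE /= fmM eqxx mulr1n.
  move=> -[v']; rewrite !inE => /andP[ne_v _].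
  rewrite -[mmul _ _ == _]val_eqE /= fmM /= eqseq_cat // eqxx /=.
  by rewrite -[v' == v]/(FMonom v' == FMonom v) (negbTE ne_v).
move=> -[u']; rewrite !inE => /andP[ne_u /orP[eq_u|]]; first by rewrite eq_u in ne_u.
rewrite -wcoef_supp => /hom_f size_u'; apply: big1 => -[v'] _.
rewrite -[mmul _ _ == _]val_eqE /= fmM /= eqseq_cat ?size_u' ?size_u //.
by rewrite -[u' == u]/(FMonom u' == FMonom u) (negbTE ne_u).
Qed.

Lemma wcoef_fvar i u : wcoef (fvar K i) u = ([:: i] == u)%:R.
Proof. by rewrite /fvar fmuE wcoefU. Qed.

Lemma wcoef_fvar_neq0 i u : wcoef (fvar K i) u != 0 -> u = [:: i].
Proof. by rewrite wcoef_fvar; case: ([:: i] =P u) => // _; rewrite eqxx. Qed.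

Lemma wcoef_fvarM i f j u : wcoef (fvar K i * f) (j :: u) = wcoef f u *+ (i == j).
Proof.
rewrite -cat1s (@wcoefM_cat 1) // => [|u' /wcoef_fvar_neq0 -> //].
by rewrite wcoef_fvar eqseq_cons andbT mulr_natl.
Qed.

Lemma wcoef_fvarM_nil i f : wcoef (fvar K i * f) [::] = 0.
Proof.
by apply/eqP/negP => /negP/wcoefM_neq0[u1 [u2 [+ /wcoef_fvar_neq0 def_u1]]]; rewrite def_u1.
Qed.

Lemma ncdeg_homog n f : f != 0 -> (forall u, wcoef f u != 0 -> size u = n) ->
  ncdeg f = n.
Proof.
move=> nz_f hom_f; rewrite /ncdeg.
suff -> : mmeasure (@fdeg I) f = n.+1 by [].
have hom m : m \in msupp f -> fdeg m = n.
  by case: m => u; rewrite -wcoef_supp => /hom_f.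
apply/eqP; rewrite eqn_leq; apply/andP; split.
  rewrite mmeasureE big_seq; elim/big_rec: _ => // m k /hom deg_m le_k.
  by rewrite geq_max le_k andbT -deg_m.
have [m m_f] : exists m, m \in msupp f.
  by apply/fset0Pn; rewrite msupp_eq0.
by rewrite -(hom m m_f); apply: mmeasure_mnm_lt.
Qed.

End Coef.

Lemma left_decomp (K : fieldType) (f : freealg K 'I_2) :
  exists c a b, f = c%:MP + ncx K * a + ncy K * b.
Proof.
pose P f := exists c a b, f = c%:MP + ncx K * a + ncy K * b.
rewrite -/(P f) [f]monalgE; apply: (big_ind P).
- by exists 0, 0, 0; rewrite malgC0E !mulr0 !addr0.
- move=> _ _ [c [a [b ->]]] [c' [a' [b' ->]]]; exists (c + c'), (a + a'), (b + b').
  by rewrite mulrDr [ncy K * (_ + _)]mulrDr raddfD addrACA [X in X + _]addrACA.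
move=> [[|i u]] _; set k := _@__.
  exists k, 0, 0; rewrite !mulr0 !addr0; congr (<< _ *g _ >>).
  by apply/eqP; rewrite -val_eqE /= fm1.
have def_iu : FMonom (i :: u) = mmul (fmu i) (FMonom u).
  by apply/eqP; rewrite -val_eqE /= fmM fmU.
have -> : << k *g FMonom (i :: u) >> = fvar K i * << k *g FMonom u >>.
  by rewrite /fvar malgM_def fgmulUU mul1r def_iu.
case: (letterP i) => ->; [exists 0, << k *g FMonom u >>, 0 | exists 0, 0, << k *g FMonom u >>];
  by rewrite malgC0E mulr0 ?add0r ?addr0.
Qed.

(** * Invariants are determined by their coefficients on Dyck words *)

Section Difference.
Variables (A : nzRingType) (U : {rmorphism A -> A}).

Definition delta (a : A) : A := U a - a.

Lemma delta_is_additive : additive delta.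
Proof.
by move=> a b; rewrite /delta raddfB !opprB [b - a]addrC addrACA [- U b + b]addrC.
Qed.

HB.instance Definition _ := GRing.isAdditive.Build A A delta delta_is_additive.

Lemma iter_delta0 k : iter k delta 0 = 0.
Proof. by elim: k => //= k ->; rewrite raddf0. Qed.

Lemma delta_comm a : delta (U a) = U (delta a).
Proof. by rewrite /delta raddfB. Qed.

Variables (x y : A).
Hypothesis (Ux : U x = x) (Uy : U y = x + y).

Lemma delta_xy a b : delta (x * a + y * b) = x * (delta a + U b) + y * delta b.
Proof.
rewrite /delta rmorphD !rmorphM Ux Uy mulrDl !mulrDr !mulrN opprD.
by rewrite [LHS](AC ((1*2)*2) ((1*4*2)*(3*5))).
Qed.

(** The Leibniz rule for the powers of [delta]: as [delta x = 0] and
    [delta y = x], only one factor [delta] can hit [y], and it may be any of the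
    [k] factors; [U] is the twist of the finite difference of a product. *)
Lemma iter_delta_xy k a b : iter k delta (x * a + y * b) =
  x * (iter k delta a + U (iter k.-1 delta b) *+ k) + y * iter k delta b.
Proof.
elim: k => [|k IH] /=; first by rewrite mulr0n addr0.
rewrite IH delta_xy raddfD raddfMn /= delta_comm mulrSr -!addrA.
by case: k {IH} => [|k] //=; rewrite !mulr0n !add0r.
Qed.

End Difference.

(** The element x f y - y f x is bilinear and alternating in x and y, so a
    linear substitution that fixes f multiplies it by its determinant.  The
    first hypothesis says that the scalars are central, which is not part of the
    structure of a left algebra. *)
Lemma bracket_substitution (K : fieldType) (A : lalgType K)
    (U : {rmorphism A -> A}) (x y f : A) (a b c d : K) :
  (forall k (p q : A), k *: (p * q) = p * (k *: q)) ->
  U x = a *: x + c *: y -> U y = b *: x + d *: y -> U f = f ->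
  U (x * f * y - y * f * x) = (a * d - b * c) *: (x * f * y - y * f * x).
Proof.
move=> scaleAr Ux Uy Uf; rewrite rmorphB !rmorphM Ux Uy Uf.
rewrite !mulrDl !mulrDr -!scalerAl -!scaleAr !scalerA.
rewrite scalerBr !scalerBl opprB.
set xx := x * f * x; set xy := x * f * y; set yx := y * f * x; set yy := y * f * y.
rewrite [b * a]mulrC [d * c]mulrC [d * a]mulrC [c * b]mulrC.
rewrite !opprD.
(* The terms in xy and in yx are collected, those in xx and in yy cancel. *)
rewrite [LHS](AC ((2*2)*(2*2)) (((2*6)*(3*7))*((1*5)*(4*8)))).
by rewrite /= !subrr !addr0.
Qed.

Lemma det_mx2 (K : fieldType) (g : 'M[K]_2) :
  \det g = g 0 0 * g 1 1 - g 0 1 * g 1 0.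
Proof.
rewrite (expand_det_row _ 0) big_ord_recl big_ord1 /cofactor !det_mx11 !mxE /=.
have e1 : lift 0 0 = 1 :> 'I_2 by exact: val_inj.
have e0 : lift 1 0 = 0 :> 'I_2 by exact: val_inj.
by rewrite !e1 e0 /= addn0 expr0 expr1 mul1r mulN1r mulrN.
Qed.

HB.instance Definition _ (K : fieldType) (g : 'M[K]_2) :=
  GRing.RMorphism.copy (mxact g) (nceval (fun i => \sum_(j < 2) g j i *: fvar K j)).

Section Action.
Variable K : fieldType.
Implicit Types (f : freealg K 'I_2) (u v : word).

Lemma mxact_fvar (g : 'M[K]_2) i :
  mxact g (fvar K i) = g 0 i *: ncx K + g 1 i *: ncy K.
Proof.
rewrite /mxact /fvar ncevalU scale1r /wordval fmU big_seq1 big_ord_recl big_ord1.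
by have -> : lift ord0 ord0 = 1 :> 'I_2 by exact: val_inj.
Qed.

Lemma invariantM f f' :
  SL2_invariant f -> SL2_invariant f' -> SL2_invariant (f * f').
Proof.
move=> inv_f inv_f' g det_g.
by rewrite rmorphM /= (inv_f g det_g) (inv_f' g det_g).
Qed.

Lemma invariant1 : SL2_invariant (1 : freealg K 'I_2).
Proof. by move=> g _; rewrite rmorph1. Qed.

Lemma invariant_bracket f : SL2_invariant f ->
  SL2_invariant (ncx K * f * ncy K - ncy K * f * ncx K).
Proof.
move=> inv_f g det_g.
have /= -> := @bracket_substitution K (freealg K 'I_2) (mxact g) (ncx K) (ncy K) f
  _ _ _ _ (@malg_scaleAr K 'I_2) (mxact_fvar g 0) (mxact_fvar g 1) (inv_f g det_g).
by rewrite -det_mx2 det_g scale1r.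
Qed.
End Action.

Section HighestWeight.
Variable K : fieldType.
Implicit Types (f : freealg K 'I_2) (u v : word).

(** The shear fixes x and sends y to x + y.  Its difference operator [Delta] is
    the finite counterpart of the raising operator of the Lie algebra sl_2. *)
Definition shear : 'M[K]_2 := \matrix_(i, j) (i <= j)%N%:R.

Lemma shear_x : mxact shear (ncx K) = ncx K.
Proof. by rewrite mxact_fvar !mxE /= scale1r scale0r addr0. Qed.

Lemma shear_y : mxact shear (ncy K) = ncx K + ncy K.
Proof. by rewrite mxact_fvar !mxE /= !scale1r. Qed.

Lemma det_shear : \det shear = 1.
Proof. by rewrite det_mx2 !mxE /= mulr1 mulr0 subr0. Qed.

Local Notation Delta := (delta (mxact shear)).

Lemma wcoef_xy a b :
  [/\ forall u, wcoef (ncx K * a + ncy K * b) (0 :: u) = wcoef a u,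
      forall u, wcoef (ncx K * a + ncy K * b) (1 :: u) = wcoef b u
    & wcoef (ncx K * a + ncy K * b) [::] = 0].
Proof.
have wcoef_ab u : wcoef (ncx K * a + ncy K * b) u = wcoef (ncx K * a) u + wcoef (ncy K * b) u.
  exact: wcoefD.
split=> [u|u|]; apply: etrans (wcoef_ab _) _.
- exact: etrans (congr2 +%R (wcoef_fvarM 0 a 0 u) (wcoef_fvarM 1 b 0 u)) (addr0 _).
- exact: etrans (congr2 +%R (wcoef_fvarM 0 a 1 u) (wcoef_fvarM 1 b 1 u)) (add0r _).
- exact: etrans (congr2 +%R (wcoef_fvarM_nil 0 a) (wcoef_fvarM_nil 1 b)) (addr0 _).
Qed.

Lemma xy_eq0 a b : ncx K * a + ncy K * b = 0 -> a = 0 /\ b = 0.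
Proof.
move=> ab0; have [wcoef_a wcoef_b _] := wcoef_xy a b.
by split; apply: wcoefP => u; rewrite wcoef0 -1?wcoef_a -1?wcoef_b ab0 wcoef0.
Qed.

(** By induction on the degree.  The constant term vanishes, because the empty
    word has weight zero and is a Dyck word, so that f = x a + y b; here
    iteration of [Delta] is written as a power.  The Leibniz rule gives
    [Delta ^ h.+1 b = 0] and [Delta ^ h.+1 a = - (h + 1) U (Delta ^ h b)], where
    [U] is the shear; so [a] satisfies the hypotheses at height [h + 1] and
    vanishes.  Then [U (Delta ^ h b) = 0], since the characteristic is zero,
    and [Delta ^ h b = U (Delta ^ h b) - Delta ^ h.+1 b = 0]: either [h = 0] and
    [b = 0], or [b] satisfies the hypotheses at height [h - 1].  These moves of
    the height are exactly those of [dyck]. *)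
Lemma highest_weight_eq0 (charK : [pchar K] =i pred0) n f h :
    (forall u, wcoef f u != 0 -> (size u < n)%N) ->
    iter h.+1 Delta f = 0 ->
    (forall u, wcoef f u != 0 -> (h + count_mem 0%R u = count_mem 1%R u)%N) ->
    (forall u, dyck h u -> wcoef f u = 0) ->
  f = 0.
Proof.
elim: n f h => [|n IH] f h size_f Df wt_f dyck_f.
  by apply: wcoefP => u; rewrite wcoef0; apply/eqP; apply: contraT => /size_f.
have [c [a [b def_f]]] := left_decomp f.
have [wcoef_a wcoef_b wcoef_nil] := wcoef_xy a b.
have {}wcoef_a u : wcoef f (0 :: u) = wcoef a u.
  by rewrite def_f -addrA wcoefD wcoef_a /wcoef mcoeffC -val_eqE /= fm1 add0r.
have {}wcoef_b u : wcoef f (1 :: u) = wcoef b u.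
  by rewrite def_f -addrA wcoefD wcoef_b /wcoef mcoeffC -val_eqE /= fm1 add0r.
have c0 : c = 0.
  have <- : wcoef f [::] = c.
    by rewrite def_f -addrA wcoefD wcoef_nil addr0 /wcoef mcoeffC -val_eqE /= fm1.
  apply/eqP; apply: contraT => nz; have := wt_f _ nz; rewrite /= addn0 => h0.
  by rewrite dyck_f ?eqxx /= ?h0 // in nz.
have {}def_f : f = ncx K * a + ncy K * b by rewrite def_f c0 malgC0E add0r.
have size_a u : wcoef a u != 0 -> (size u < n)%N by rewrite -wcoef_a => /size_f.
have size_b u : wcoef b u != 0 -> (size u < n)%N by rewrite -wcoef_b => /size_f.
have := Df; rewrite def_f (iter_delta_xy shear_x shear_y) => /xy_eq0[Da Db].
have a0 : a = 0.
  apply: (IH a h.+1) => // [|u|u du].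
  - rewrite iterS; move/eqP: Da; rewrite addr_eq0 => /eqP ->.
    by rewrite raddfN raddfMn /= delta_comm -[delta _ _]/(iter h.+1 Delta b) Db rmorph0 mul0rn oppr0.
  - by rewrite -wcoef_a => /wt_f /=; rewrite add0n add1n addnS.
  - by rewrite -wcoef_a dyck_f.
have b0 : iter h Delta b = 0.
  move: Da; rewrite a0 iter_delta0 add0r /= -scaler_nat => /eqP.
  rewrite scaler_eq0 ((pcharf0P K).1 charK) /= => /eqP Ub.
  have : mxact shear (iter h Delta b) - iter h Delta b = 0 := Db.
  by rewrite Ub sub0r => /eqP; rewrite oppr_eq0 => /eqP.
suff -> : b = 0 by rewrite a0 !mulr0 addr0.
case: h => [|h] in wt_f dyck_f b0 {Df Da Db} *; first exact: b0.
apply: (IH b h) => // [u|u du]; last by rewrite -wcoef_b dyck_f.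
by rewrite -wcoef_b => /wt_f /=; rewrite add0n add1n addSn => -[].
Qed.

(** A single diagonal matrix is enough to force weight zero: its eigenvalue on a
    word is [2] to the power of the weight, and [2] is not a root of unity. *)
Definition torus : 'M[K]_2 :=
  \matrix_(i, j) (if i == j then if i == 0 then 2 else 2^-1 else 0).

Lemma wcoef_torus f u :
  wcoef (mxact torus f) u =
  2 ^+ count_mem 0%R u * 2^-1 ^+ count_mem 1%R u * wcoef f u.
Proof.
pose t u : K := 2 ^+ count_mem 0%R u * 2^-1 ^+ count_mem 1%R u.
have wordval_t v : wordval (fun i => \sum_(j < 2) torus j i *: fvar K j) (FMonom v)
    = t v *: << FMonom v >>.
  rewrite /wordval /=; elim: v => [|i v IH].
    rewrite big_nil /t !expr0 mul1r scale1r; congr << _ *g _ >>.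
    by apply/eqP; rewrite -val_eqE /= fm1.
  rewrite big_cons IH.
  have -> : \sum_(j < 2) torus j i *: fvar K j = t [:: i] *: fvar K i.
    rewrite big_ord_recl big_ord1 /t; have -> : lift ord0 ord0 = 1 :> 'I_2 by exact: val_inj.
    case: (letterP i) => ->; rewrite !mxE /t /= scale0r ?addr0 ?add0r.
      by rewrite expr0 expr1 mulr1; congr (_ *: fvar K _).
    by rewrite !addn0 expr0 expr1 mul1r; congr (_ *: fvar K _).
  rewrite -scalerAl -malg_scaleAr scalerA.
  have -> : fvar K i * << FMonom v >> = << FMonom (i :: v) >>.
    rewrite /fvar malgM_def fgmulUU mulr1; congr << _ *g _ >>.
    by apply/eqP; rewrite -val_eqE /= fmM fmU.
  have -> : t (i :: v) = t [:: i] * t v by rewrite /t /= !addn0 !exprD mulrACA.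
  congr (_ *: _).
rewrite -/(t u) {1}[f]monalgE /mxact (raddf_sum (nceval _)) wcoef_sum /=.
rewrite [in RHS](monalgE f) wcoef_sum mulr_sumr; apply: eq_bigr => -[v] _.
rewrite ncevalU wordval_t !wcoefZ.
rewrite [in LHS]wcoefU [in RHS]wcoefU mulrCA; case: eqP => [->|_].
  by rewrite !mulr1n mulr1.
by rewrite !mulr0n !mulr0.
Qed.

Lemma det_torus (charK : [pchar K] =i pred0) : \det torus = 1.
Proof.
by rewrite det_mx2 !mxE /= mulr0 subr0 mulfV // ((pcharf0P K).1 charK).
Qed.

Lemma expr2_inj (charK : [pchar K] =i pred0) (m n : nat) :
  2 ^+ m = 2 ^+ n :> K -> m = n.
Proof.
wlog le_mn : m n / (m <= n)%N.
  by move=> W; have [/W//|/ltnW/W H /esym/H] := leqP m n.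
rewrite -!natrX => /esym/eqP; rewrite -subr_eq0 -natrB ?leq_pexp2l //.
rewrite ((pcharf0P K).1 charK) subn_eq0 leq_exp2l // => le_nm.
by apply/eqP; rewrite eqn_leq le_mn.
Qed.

(** Invariance under the shear says that [Delta f = 0], and invariance under the
    torus that every word of [f] has as many x as y: this is height [0]. *)
Lemma invariant_eq0 (charK : [pchar K] =i pred0) f :
  SL2_invariant f -> (forall u, dyck 0 u -> wcoef f u = 0) -> f = 0.
Proof.
move=> inv_f; apply: (@highest_weight_eq0 charK (mmeasure (@fdeg 'I_2) f)).
- by move=> u; rewrite wcoef_supp => /(mmeasure_mnm_lt (@fdeg 'I_2)).
- by rewrite iterS /delta /= (inv_f _ det_shear) subrr.
move=> u nz_u; have := wcoef_torus f u; rewrite inv_f ?det_torus //.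
rewrite -[LHS]mul1r => /(mulIf nz_u)/esym; rewrite exprVn => /divr1_eq.
exact: expr2_inj.
Qed.

End HighestWeight.

(** * Leading words and triangularity *)

Section Lead.
Variable K : fieldType.
Implicit Types (f g : freealg K 'I_2) (u v d e : word).

(** [f] is homogeneous, with lexicographically largest word [d] and leading
    coefficient [1]. *)
Definition lead f d : Prop :=
  wcoef f d = 1 /\
  (forall u, wcoef f u != 0 -> size u = size d /\ (code u <= code d)%N).

Lemma lead1 : lead 1 [::].
Proof.
have c1 u : wcoef (1 : freealg K 'I_2) u = (u == [::])%:R.
  by rewrite /wcoef mcoeff1 -val_eqE /= fm1.
split=> [|u]; first by rewrite c1.
by rewrite c1; case: (u =P [::]) => [->//|_]; rewrite eqxx.
Qed.

Lemma leadM f g d e : lead f d -> lead g e -> lead (f * g) (d ++ e).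
Proof.
move=> [f_d le_d] [g_e le_e]; split.
  apply: etrans (@wcoefM_cat K _ (size d) f g d e _ erefl) _.
    by move=> u /le_d[].
  by rewrite f_d g_e mulr1.
move=> u /wcoefM_neq0[u1 [u2 [-> /le_d[s1 c1] /le_e[s2 c2]]]].
by rewrite !size_cat s1 s2; split=> //; apply: code_cat_le.
Qed.

Definition bracket f := ncx K * f * ncy K - ncy K * f * ncx K.

Lemma wcoef_sandwich_neq0 i j f u :
  wcoef (fvar K i * f * fvar K j) u != 0 ->
  exists2 v, u = i :: rcons v j & wcoef f v != 0.
Proof.
move=> /wcoefM_neq0[u1 [u2 [-> u1_0 /wcoef_fvar_neq0 ->]]].
have [u3 [u4 [-> /wcoef_fvar_neq0 -> u4_0]]] := wcoefM_neq0 u1_0.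
by exists u4; rewrite // -cats1.
Qed.

(** In x f y - y f x the words of the second product all start with y, so they
    are smaller than those of the first one. *)
Lemma lead_bracket f d : lead f d -> lead (bracket f) (0%R :: rcons d 1%R).
Proof.
move=> [f_d le_d].
have size_f i u : wcoef (fvar K i * f) u != 0 -> size u = (size d).+1.
  by move=> /wcoefM_neq0[u1 [u2 [-> /wcoef_fvar_neq0 -> /le_d[/= ->]]]].
split.
  have c i j : wcoef (fvar K i * f * fvar K j) (0 :: rcons d 1) = ((i == 0) && (j == 1))%:R.
    rewrite -cats1 -cat_cons.
    apply: etrans (@wcoefM_cat K _ (size d).+1 (fvar K i * f) (fvar K j) (0 :: d) [:: 1] (@size_f i) erefl) _.
    rewrite wcoef_fvarM wcoef_fvar f_d eqseq_cons andbT.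
    by case: (i == 0); case: (j == 1); rewrite ?mulr1 ?mul0r ?mulr0.
  apply: etrans (wcoefB _ _ _) _.
  exact: etrans (congr2 (fun a b => a - b) (c 0 1) (c 1 0)) (subr0 _).
move=> u; have [xfy|xfy _] := eqVneq (wcoef (ncx K * f * ncy K) u) 0; last first.
  have [v -> /le_d[s_v c_v]] := wcoef_sandwich_neq0 xfy.
  rewrite /= !size_rcons s_v; split=> //; rewrite leq_add2r -!cats1.
  exact: code_cat_le.
have -> : wcoef (bracket f) u = 0 - wcoef (ncy K * f * ncx K) u.
  exact: etrans (wcoefB _ _ _) (congr1 (fun a => a - _) xfy).
rewrite sub0r oppr_eq0 => yfx.
have [v -> /le_d[s_v _]] := wcoef_sandwich_neq0 yfx.
by split; [rewrite /= !size_rcons s_v | apply: code_yx; rewrite !size_rcons s_v].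
Qed.

Lemma lead_ncdeg f d : lead f d -> ncdeg f = size d.
Proof.
move=> [f_d le_d]; apply: ncdeg_homog => [|u /le_d[]//].
by apply: contra_eq_neq f_d => ->; rewrite wcoef0 eq_sym oner_eq0.
Qed.

Lemma lead_prod (w : nat -> freealg K 'I_2) (wd : nat -> word) (s : seq nat) :
  (forall i, i \in s -> lead (w i) (wd i)) ->
  lead (gen_prod w s) (flatten (map wd s)).
Proof.
rewrite /gen_prod; elim: s => [|i s IH] lead_w; first by rewrite big_nil; apply: lead1.
rewrite big_cons /=; apply: leadM; first by apply: lead_w; rewrite mem_head.
by apply: IH => j js; apply: lead_w; rewrite in_cons js orbT.
Qed.

Lemma bracket1 : bracket 1 = ncx K * ncy K - ncy K * ncx K.
Proof.
have x1 : ncx K * 1 = ncx K := mulr1 _; have y1 : ncy K * 1 = ncy K := mulr1 _.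
exact: (congr2 (fun a b : freealg K 'I_2 => a * ncy K - b * ncx K) x1 y1).
Qed.

End Lead.

(** For a linear map that sends the basis of words to elements with leading
    words [W s], the system is unitriangular, so injectivity and spanning are
    read off [W]. *)
Section Triangular.
Variables (K : fieldType) (J : choiceType).
Variable (L : {linear freealg K J -> freealg K 'I_2}) (W : {fmonom J} -> word).
Hypothesis lead_L : forall s, lead (L << s >>) (W s).

Lemma lead_linearE p : L p = \sum_(s <- msupp p) p@_s *: L << s >>.
Proof.
rewrite {1}[p]monalgE linear_sum; apply: eq_bigr => s _.
have -> : << p@_s *g s >> = p@_s *: << s >> :> freealg K J.
  by apply/malgP => t; rewrite mcoeffZ [in LHS]mcoeffU [in RHS]mcoeffU mulr_natr.
by rewrite linearZ.
Qed.

(** The coefficient of [p] at [s] is shown to vanish by descending induction on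
    the rank of [W s]: the coefficient of [L p] at [W s] is the coefficient of
    [p] at [s] plus contributions of words [t] with [W t] above [W s], and the
    coefficients of [p] at these words vanish already. *)
Lemma lead_linear_inj : injective W -> injective L.
Proof.
move=> inj_W; apply: raddf_inj => p Lp0.
pose B := (\max_(s <- msupp p) code (W s))%N.
have le_B s : s \in msupp p -> (code (W s) <= B)%N.
  by move=> s_p; rewrite /B (big_fsetD1 s) //= leq_maxl.
suff p0 n s : (B < code (W s) + n)%N -> p@_s = 0.
  by apply/malgP => s; rewrite mcoeff0; apply: (p0 B.+1); rewrite addnS ltnS leq_addl.
elim: n s => [|n IH] s.
  rewrite addn0 => lt_B; apply: mcoeff_outdom; apply: contraTN lt_B => /le_B.
  by rewrite -leqNgt.
move=> le_Bs; apply/eqP; apply: contraT => nz_s.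
suff : wcoef (L p) (W s) = p@_s.
  by rewrite Lp0 wcoef0 => /esym/eqP; rewrite (negbTE nz_s).
rewrite lead_linearE wcoef_sum (big_fsetD1 s) /=; last by rewrite -mcoeff_neq0.
rewrite [X in X + _ = _]wcoefZ (lead_L s).1 mulr1 [X in _ + X = _]big_seq.
rewrite [X in _ + X = _]big1 ?addr0 // => t.
rewrite !inE => /andP[ne_ts _]; rewrite wcoefZ; apply/eqP; rewrite mulf_eq0.
apply/orP; case: (wcoef (L << t >>) (W s) =P 0) => [|/eqP nz_t]; [by right | left].
have [_ le_st] := (lead_L t).2 _ nz_t.
have : code (W s) != code (W t).
  by apply: contra_neq ne_ts => /code_inj/inj_W ->.
by move=> ne_code; apply/eqP/IH; lia.
Qed.

(** The space [V] is one in which a vector with no coefficient on [D] is zero.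
    The reduction cancels the coefficients of [f] on [D] from the highest rank
    downwards, which creates only lower words; by injectivity of [code] there
    is at most one word to cancel at each rank. *)
Lemma lead_linear_span (V : freealg K 'I_2 -> Prop) (D : pred word) :
    (forall d, D d -> exists s, W s = d) ->
    (forall c f s, V f -> V (f - c *: L << s >>)) ->
    (forall f, V f -> (forall d, D d -> wcoef f d = 0) -> f = 0) ->
  forall f, V f -> exists p, L p = f.
Proof.
move=> surj_W V_L V_eq0 f.
pose B := (\max_(m <- msupp f) code (m : {fmonom 'I_2}))%N.
have : forall d, D d -> (B.+1 <= code d)%N -> wcoef f d = 0.
  move=> d _; apply: contraTeq; rewrite wcoef_supp -leqNgt => d_f.
  by rewrite /B (big_fsetD1 (FMonom d)) //= leq_maxl.
move: (B.+1) => {B} N; elim: N f => [|N IH] f D_f Vf.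
  by exists 0; rewrite raddf0 (V_eq0 f) // => d Dd; apply: D_f.
pose top := [pred m : {fmonom 'I_2} | D m && (code m == N)].
have [/hasP[d d_f /andP[/= Dd /eqP code_d]]|/hasPn no_top] := boolP (has top (msupp f)).
  have [s W_s] := surj_W _ Dd.
  have [f1 le_f1] := lead_L s; rewrite W_s in f1 le_f1.
  have [||p Lp] := IH (f - wcoef f d *: L << s >>); last first.
  - exists (p + wcoef f d *: << s >>).
    by rewrite linearD linearZ /= Lp subrK.
  - exact: V_L.
  move=> e De le_N; rewrite wcoefB wcoefZ; have [eq_N|ne_N] := eqVneq (code e) N.
    have -> : e = d by apply: code_inj; rewrite eq_N.
    by rewrite f1 mulr1 subrr.
  have lt_N : (N < code e)%N by rewrite ltn_neqAle eq_sym ne_N.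
  rewrite D_f // sub0r; apply/eqP; rewrite oppr_eq0 mulf_eq0; apply/orP; right.
  by apply: contraTT lt_N => /le_f1[_]; rewrite code_d -leqNgt.
apply: IH => // e De; rewrite leq_eqVlt => /predU1P[eq_N|/(D_f e De)//].
apply: contraTeq isT; rewrite wcoef_supp => /no_top /=.
by rewrite De eq_N eqxx.
Qed.
End Triangular.

(** * The leading words of a run of the procedure *)

(** The word of largest rank of [f]; it makes the leading words of the
    generators into a function of their index. *)
Definition lead_word (K : fieldType) (f : freealg K 'I_2) : word :=
  head [::] [seq fmonom_val u | u : {fmonom 'I_2} <- msupp f &
    all (fun v : {fmonom 'I_2} => (code v <= code u)%N) (msupp f)].

Lemma lead_wordE (K : fieldType) (f : freealg K 'I_2) d :
  lead f d -> lead_word f = d.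
Proof.
move=> [f_d le_d]; rewrite /lead_word.
set s := [seq u <- _ | _].
have d_f : FMonom d \in msupp f by rewrite -wcoef_supp f_d oner_eq0.
have d_s : FMonom d \in s.
  by rewrite mem_filter d_f andbT; apply/allP => -[v]; rewrite -wcoef_supp => /le_d[].
have s_d u : u \in s -> (u : word) = d.
  rewrite mem_filter => /andP[/allP/(_ _ d_f) /= le_du].
  case: u le_du => u /=; rewrite -wcoef_supp => le_du /le_d[_ le_ud].
  by apply: code_inj; apply/eqP; rewrite eqn_leq le_ud.
by case: s d_s s_d => //= u s _; apply; rewrite mem_head.
Qed.

(** When [w] comes from a run of the procedure, [gen_word w i] is a prime Dyck word (one that
    returns to height [0] only at its end), and [prod_word w s] is the Dyck word
    whose prime factors are those of the generators listed in [s]. *)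
Definition gen_word (K : fieldType) (w : nat -> freealg K 'I_2) (i : nat) :=
  lead_word (w i).

Definition prod_word (K : fieldType) (w : nat -> freealg K 'I_2) (s : seq nat) :=
  flatten (map (gen_word w) s).

Section Procedure.
Variables (K : fieldType) (w : nat -> freealg K 'I_2) (k : nat -> nat).
Variables (om : nat -> seq (seq nat)).
Hypothesis proc : procedure w k om.

Local Notation wd := (gen_word w).
Local Notation W := (prod_word w).

Lemma first_bracket : w 0 = bracket 1.
Proof. by rewrite bracket1; have := proc_first proc. Qed.

Lemma new_bracket n j : (j < size (om n.+1))%N ->
  w (k n.+1 + j) = bracket (gen_prod w (nth [::] (om n.+1) j)).
Proof. exact: (proc_new proc (ltn0Sn n)). Qed.

Lemma index_cases n i : (i < k n.+1)%N -> i = 0%N \/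
  exists m j, [/\ (m < n)%N, (j < size (om m.+1))%N & i = (k m.+1 + j)%N].
Proof.
elim: n => [|n IH]; first by rewrite (proc_k1 proc); left; lia.
rewrite (proc_kS proc) // => lt_i; case: (ltnP i (k n.+1)) => [/IH[->|]|le_i].
- by left.
- by move=> [m [j [lt_m lt_j ->]]]; right; exists m, j; split=> //; apply: ltnW.
right; exists n, (i - k n.+1)%N; split=> //; first by rewrite ltn_subLR.
by rewrite subnKC.
Qed.

Lemma om_nthP n j : (j < size (om n.+1))%N ->
  let s := nth [::] (om n.+1) j in
  {in s, forall i, (i < k n.+1)%N} /\ ncdeg (gen_prod w s) = (2 * n.+1)%N.
Proof.
move=> /(mem_nth [::]); rewrite (proc_products proc) // => /and3P[_ /allP lt_s /eqP].
by split.
Qed.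

Lemma gen_lead n i : (i < k n.+1)%N ->
  exists e, [/\ dyck 0 e, lead (w i) (0%R :: rcons e 1%R) & (size e <= 2 * n)%N].
Proof.
elim/ltn_ind: n i => n IH i /index_cases[->|[m [j [lt_m lt_j ->]]]].
  exists [::]; split=> //; rewrite first_bracket.
  exact: (lead_bracket (@lead1 K)).
have [lt_s deg_s] := om_nthP lt_j; rewrite new_bracket //.
move: (nth _ _ _) lt_s deg_s => s lt_s deg_s.
have lead_s i' : i' \in s -> exists2 e, dyck 0 e & lead (w i') (0%R :: rcons e 1%R).
  by move=> /lt_s/(IH _ lt_m)[e [? ? _]]; exists e.
have lead_ws : lead (gen_prod w s) (W s).
  by apply: lead_prod => i' /lead_s[e _ lead_e]; rewrite /gen_word (lead_wordE lead_e).
exists (W s); split; last 1 first.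
- by rewrite -(lead_ncdeg lead_ws) deg_s leq_mul2l.
- apply: dyck_flatten; apply/allP => _ /mapP[i' /lead_s[e de lead_e] ->].
  by rewrite /gen_word (lead_wordE lead_e) /= -cats1 (@dyck_cat 0 1).
exact: lead_bracket.
Qed.

Lemma k_gt0 n : (0 < k n.+1)%N.
Proof.
elim: n => [|n IH]; first by rewrite (proc_k1 proc).
by rewrite (proc_kS proc) // addn_gt0 IH.
Qed.

Lemma lead_w0 : lead (w 0) [:: 0%R; 1%R].
Proof. by rewrite first_bracket; apply: (lead_bracket (@lead1 K)). Qed.

(** The power of the first generator is always among the products. *)
Lemma om_gt0 n : (0 < size (om n.+1))%N.
Proof.
suff : nseq n.+1 0%N \in om n.+1 by case: (om n.+1).
have lead_s : lead (gen_prod w (nseq n.+1 0%N))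
    (flatten (map (fun=> [:: 0%R; 1%R]) (nseq n.+1 0%N))).
  by apply: lead_prod => i; rewrite mem_nseq => /andP[_ /eqP ->]; apply: lead_w0.
rewrite (proc_products proc) // (lead_ncdeg lead_s) all_nseq k_gt0 orbT.
by rewrite size_flatten /shape -map_comp map_nseq sumn_nseq /=; apply/eqP; lia.
Qed.

Lemma k_mono m n : (m <= n)%N -> (k m.+1 <= k n.+1)%N.
Proof.
elim: n => [|n IH]; first by rewrite leqn0 => /eqP ->.
rewrite leq_eqVlt ltnS => /predU1P[-> //|/IH le_k].
by rewrite (proc_kS proc (ltn0Sn n)) (leq_trans le_k) // leq_addr.
Qed.

Lemma lt_k n : (n < k n.+1)%N.
Proof.
elim: n => [|n IH]; first exact: k_gt0.
by rewrite (proc_kS proc (ltn0Sn n)); have := om_gt0 n; lia.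
Qed.

Lemma lead_gen i : exists2 e, dyck 0 e & wd i = 0 :: rcons e 1 /\ lead (w i) (wd i).
Proof.
have [e [de lead_e _]] := gen_lead (lt_k i).
by exists e; rewrite // /gen_word (lead_wordE lead_e).
Qed.

Lemma lead_gen_prod s : lead (gen_prod w s) (W s).
Proof. by apply: lead_prod => i _; have [e _ []] := lead_gen i. Qed.

Lemma dyck_prod_word s : dyck 0 (W s).
Proof.
apply: dyck_flatten; apply/allP => _ /mapP[i _ ->].
by have [e de [-> _]] := lead_gen i; rewrite /= -cats1 (@dyck_cat 0 1).
Qed.

Lemma gen_word0 : wd 0 = [:: 0; 1].
Proof. exact: lead_wordE lead_w0. Qed.

Lemma gen_word_new n j : (j < size (om n.+1))%N ->
  wd (k n.+1 + j) = 0 :: rcons (W (nth [::] (om n.+1) j)) 1.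
Proof.
by move=> lt_j; apply: lead_wordE; rewrite new_bracket //; apply/lead_bracket/lead_gen_prod.
Qed.

Lemma size_om_word n j : (j < size (om n.+1))%N ->
  size (W (nth [::] (om n.+1) j)) = (2 * n.+1)%N.
Proof. by move=> /om_nthP[_ <-]; rewrite (lead_ncdeg (lead_gen_prod _)). Qed.

Lemma lt_k_size n i : (i < k n.+1)%N = (size (wd i) <= 2 * n.+1)%N.
Proof.
apply/idP/idP => [lt_i|].
  have [e [_ lead_e]] := gen_lead lt_i.
  by rewrite /gen_word (lead_wordE lead_e) /= size_rcons; lia.
have [->|[m [j [_ lt_j ->]]]] := index_cases (lt_k i); first by rewrite k_gt0.
rewrite gen_word_new // /= size_rcons size_om_word // => le_mn.
have : (k m.+2 <= k n.+1)%N by apply: k_mono; lia.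
by rewrite (proc_kS proc (ltn0Sn m)); lia.
Qed.

(** A product has degree 2n as soon as its leading word has length 2n, and its
    factors, being no longer than the product, are already constructed. *)
Lemma mem_om n s : (s \in om n.+1) = (size (W s) == 2 * n.+1)%N.
Proof.
rewrite (proc_products proc) // (lead_ncdeg (lead_gen_prod s)).
apply/and3P/idP => [[] //|/eqP size_s]; split; last exact/eqP.
  by apply: contra_eq_neq size_s => ->.
apply/allP => i i_s; rewrite lt_k_size -size_s.
rewrite /prod_word size_flatten /shape -map_comp; elim: s i_s {size_s} => //= j s IH.
rewrite in_cons => /predU1P[->|/IH le_i]; first exact: leq_addr.
by apply: leq_trans le_i _; apply: leq_addl.
Qed.

(** A nonempty Dyck word is x e y v with [e] and [v] shorter Dyck words.  If [e]
    is empty, x e y is the word of the first generator.  Otherwise [e] is by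
    induction the word of a product, which was numbered at its own degree and
    gave rise to a generator with leading word x e y. *)
Lemma prod_word_surj d : dyck 0 d -> exists s, W s = d.
Proof.
have [n] := ubnP (size d); elim: n => // n IH in d *.
case: d => [|i d] /=; first by exists [::].
rewrite ltnS; case: (letterP i) => -> //= lt_d /first_return[e [v [def_d de dv]]].
move: lt_d; rewrite def_d size_cat /= => lt_d.
have [|t W_t] := IH e _ de; first by lia.
have [|s W_s] := IH v _ dv; first by lia.
suff [j wd_j] : exists j, wd j = 0 :: rcons e 1.
  by exists (j :: s); rewrite /prod_word /= -/(W s) wd_j W_s /= cat_rcons.
have [e0|nz_e] := eqVneq (size e) 0%N.
  by exists 0%N; rewrite gen_word0 (size0nil e0).
have [m size_e] : exists m, size e = (2 * m.+1)%N.
  exists (size e)./2.-1; have := dyck_size_odd de.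
  by have := odd_double_half (size e); move=> + /= oe; rewrite oe; lia.
have t_om : t \in om m.+1 by rewrite mem_om W_t size_e.
by exists (k m.+1 + index t (om m.+1))%N; rewrite gen_word_new ?index_mem // nth_index // W_t.
Qed.

(** The stage of a generator is read off the length of its word, and its
    position in that stage off the inner Dyck word, which is shorter. *)
Lemma gen_word_inj_step n : (forall s t, (size (W s) < n)%N -> W s = W t -> s = t) ->
  forall i j, (size (wd i) <= n)%N -> wd i = wd j -> i = j.
Proof.
move=> prod_inj i j le_n eq_wd.
have [i0|[m [a [_ lt_a def_i]]]] := index_cases (lt_k i);
have [j0|[m' [b [_ lt_b def_j]]]] := index_cases (lt_k j).
- by rewrite i0 j0.
- have := congr1 size eq_wd; rewrite i0 def_j gen_word0 gen_word_new // /= size_rcons size_om_word //; lia.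
- have := congr1 size eq_wd; rewrite j0 def_i gen_word0 gen_word_new // /= size_rcons size_om_word //; lia.
move: eq_wd le_n; rewrite def_i def_j !gen_word_new // => -[/rcons_inj[eq_W]].
rewrite /= size_rcons => le_n.
have eq_m : m = m' by have := congr1 size eq_W; rewrite !size_om_word //; lia.
rewrite -eq_m in lt_b eq_W *; congr (_ + _)%N.
apply/eqP; rewrite -(nth_uniq [::] lt_a lt_b) ?(proc_uniq proc) //.
by apply/eqP/prod_inj => //; apply: ltn_trans le_n.
Qed.

Lemma prod_word_inj : injective W.
Proof.
suff inj n s t : (size (W s) < n)%N -> W s = W t -> s = t.
  by move=> s t; apply: inj.
elim: n s t => // n IH [|i s] [|j t] //=; rewrite /prod_word /= -!/(W _).
- by have [e _ [-> _]] := lead_gen j.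
- by have [e _ [-> _]] := lead_gen i.
have [e de [wd_i _]] := lead_gen i; have [e' de' [wd_j _]] := lead_gen j.
rewrite ltnS => lt_n eq_W.
have [eq_e eq_W'] : e = e' /\ W s = W t.
  apply: (first_return_uniq de de').
  by move: eq_W; rewrite wd_i wd_j /= !cat_rcons => -[].
have size_i : (size (wd i) <= n)%N by move: lt_n; rewrite size_cat; lia.
congr (_ :: _).
  by apply: (gen_word_inj_step IH size_i); rewrite wd_i wd_j eq_e.
by apply: IH eq_W'; move: lt_n; rewrite size_cat wd_i /=; lia.
Qed.

(** The leading words put the products of a given degree in bijection with the
    Dyck words of that length. *)
Lemma size_om n : size (om n.+1) = catalan n.+2.
Proof.
rewrite -size_dyck_words -(size_map W); apply: perm_size; apply: uniq_perm.
- by rewrite (map_inj_uniq prod_word_inj) (proc_uniq proc).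
- exact: uniq_dwords.
move=> d; rewrite mem_dwords; apply/mapP/andP => [[s]|[size_d /prod_word_surj[s W_s]]].
  by rewrite mem_om => size_s ->; rewrite size_s dyck_prod_word.
by exists s; rewrite // mem_om W_s.
Qed.

Lemma w_invariant i : SL2_invariant (w i).
Proof.
suff inv n : (i < k n.+1)%N -> SL2_invariant (w i) by apply: (inv i); apply: lt_k.
elim/ltn_ind: n i => n IH i /index_cases[->|[m [j [lt_m lt_j ->]]]].
  by rewrite first_bracket; apply/invariant_bracket/invariant1.
have [lt_s _] := om_nthP lt_j; rewrite new_bracket //; apply: invariant_bracket.
rewrite /gen_prod; move: (nth _ _ _) lt_s => s; elim: s => [|i' s IHs] lt_s.
  by rewrite big_nil; apply: invariant1.
rewrite big_cons; apply: invariantM; first exact: (IH m lt_m _ (lt_s _ (mem_head _ _))).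
by apply: IHs => i'' i_s; apply: lt_s; rewrite in_cons i_s orbT.
Qed.

End Procedure.

Lemma procedure_free_generators (K : fieldType) (charK : [pchar K] =i pred0)
    (w : nat -> freealg K 'I_2) (k : nat -> nat) (om : nat -> seq (seq nat)) :
  procedure w k om -> complete_set_of_free_generators w (@SL2_invariant K).
Proof.
move=> proc.
have lead_w (s : {fmonom nat}) : lead (nceval w << s >>) (flatten (map (fun i => lead_word (w i)) s)).
  by rewrite ncevalU scale1r; apply: (lead_gen_prod proc).
have inv_w (s : {fmonom nat}) : SL2_invariant (nceval w << s >>).
  rewrite ncevalU scale1r /wordval; elim: (s : seq nat) => [|i t IH].
    by rewrite big_nil; apply: invariant1.
  by rewrite big_cons; apply: invariantM IH; apply: (w_invariant proc).
have inv_sub c f s : SL2_invariant f -> SL2_invariant (f - c *: nceval w << s >>).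
  move=> inv_f g det_g; rewrite raddfB /= inv_f // /mxact ncevalZ -/(mxact _ _).
  by rewrite inv_w.
split; last first.
  apply: (lead_linear_inj lead_w) => -[s] [t] /(prod_word_inj proc) /= -> //.
move=> f; split.
  apply: (lead_linear_span lead_w (D := dyck 0)) => [d /(prod_word_surj proc)[s W_s]|//|g].
    by exists (FMonom s).
  exact: invariant_eq0.
move=> [p <-] g det_g; rewrite (lead_linearE (nceval w)) raddf_sum /=; apply: eq_bigr => s _.
by rewrite /mxact ncevalZ -/(mxact _ _) inv_w.
Qed.

(** * A run of the procedure exists *)

Section Existence.
Variable K : fieldType.
Implicit Types (L : seq (freealg K 'I_2)) (s : seq nat).

Fixpoint words_upto (k n : nat) : seq (seq nat) :=
  if n is n'.+1 then
    [::] :: [seq i :: s | i <- iota 0 k, s <- words_upto k n']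
  else [:: [::]].

Lemma mem_words_upto k n s :
  (s \in words_upto k n) = (size s <= n)%N && all (fun i => i < k)%N s.
Proof.
elim: n s => [|n IH] [|i s] //=.
rewrite in_cons ltnS /=; apply/allpairsP/and3P => [[[j t] /= [j_k t_n [-> ->]]]|].
  by move: j_k t_n; rewrite mem_iota IH => j_k /andP[].
by move=> [s_n i_k s_k]; exists (i, s); rewrite mem_iota IH s_n s_k i_k.
Qed.

Definition stage_products L n : seq (seq nat) :=
  undup [seq s <- words_upto (size L) n |
    (s != [::]) && (ncdeg (gen_prod (nth 0%R L) s) == 2 * n)%N].

(** [stage n] lists the generators present when the products of degree 2(n + 1)
    are formed. *)
Fixpoint stage n : seq (freealg K 'I_2) :=
  if n is n'.+1 then
    stage n' ++ [seq bracket (gen_prod (nth 0%R (stage n')) s)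
                | s <- stage_products (stage n') n]
  else [:: bracket 1].

(** Any stage that already contains the index would do, since each stage
    extends the earlier ones; [size_stage] makes [i] such a stage. *)
Definition stage_gen i := nth 0%R (stage i) i.

Lemma eq_gen_prod (v v' : nat -> freealg K 'I_2) s :
  {in s, v =1 v'} -> gen_prod v s = gen_prod v' s.
Proof. by move=> eq_v; apply: eq_big_seq. Qed.

Lemma stage_lead n i : (i < size (stage n))%N ->
  exists d, lead (nth 0%R (stage n) i) d /\ (2 <= size d)%N.
Proof.
elim: n i => [|n IH] i.
  case: i => // _; exists [:: 0%R; 1%R]; split=> //.
  exact: (lead_bracket (@lead1 K)).
rewrite /= size_cat nth_cat size_map => lt_i; case: ltnP => [/IH //|le_i].
have lt_j : (i - size (stage n) < size (stage_products (stage n) n.+1))%N by lia.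
rewrite (nth_map [::]) //; move: (mem_nth [::] lt_j).
move: (nth [::] _ _) => s; rewrite mem_undup mem_filter mem_words_upto.
move=> /and3P[_ _ /allP s_n].
pose wd i := lead_word (nth 0%R (stage n) i).
exists (0 :: rcons (flatten (map wd s)) 1); rewrite /= size_rcons; split=> //.
apply/lead_bracket/lead_prod => j /s_n/IH[d [lead_d _]].
by rewrite /wd (lead_wordE lead_d).
Qed.

(** Every generator has degree at least 2, so that a product of degree 2n has
    at most [n] factors and is found among the [words_upto]. *)
Lemma stage_degree n s : all (fun i => i < size (stage n))%N s ->
  (2 * size s <= ncdeg (gen_prod (nth 0%R (stage n)) s))%N.
Proof.
move=> /allP s_n; pose wd i := lead_word (nth 0%R (stage n) i).
have lead_s i : i \in s -> lead (nth 0%R (stage n) i) (wd i) /\ (2 <= size (wd i))%N.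
  by move=> /s_n/stage_lead[d [lead_d ge2]]; rewrite /wd (lead_wordE lead_d).
rewrite (lead_ncdeg (lead_prod (fun i i_s => (lead_s i i_s).1))).
elim: s lead_s {s_n} => //= i s IH lead_s.
rewrite size_cat mulnS; apply: leq_add; first by have [] := lead_s i (mem_head _ _).
by apply: IH => j j_s; apply: lead_s; rewrite in_cons j_s orbT.
Qed.

Lemma stage_head n : nth 0%R (stage n) 0 = bracket 1 /\ (0 < size (stage n))%N.
Proof. by elim: n => //= n [IH1 IH2]; rewrite nth_cat IH2 size_cat addn_gt0 IH2. Qed.

Lemma size_stage n : (n < size (stage n))%N.
Proof.
elim: n => //= n IH; rewrite size_cat size_map.
suff : nseq n.+1 0%N \in stage_products (stage n) n.+1.
  by case: (stage_products _ _) => //= *; rewrite addnS ltnS ltn_addr.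
have [head_n gt0] := stage_head n.
rewrite mem_undup mem_filter mem_words_upto size_nseq leqnn all_nseq gt0 orbT andbT.
apply/andP; split=> //.
have lead_s : lead (gen_prod (nth 0%R (stage n)) (nseq n.+1 0%N))
    (flatten (map (fun=> [:: 0%R; 1%R]) (nseq n.+1 0%N))).
  apply: lead_prod => i; rewrite mem_nseq => /andP[_ /eqP ->]; rewrite head_n.
  exact: (lead_bracket (@lead1 K)).
rewrite (lead_ncdeg lead_s) size_flatten /shape -map_comp map_nseq sumn_nseq /=.
by apply/eqP; lia.
Qed.

Lemma stage_prefix m n i : (i < size (stage m))%N -> (i < size (stage n))%N ->
  nth 0%R (stage m) i = nth 0%R (stage n) i.
Proof.
wlog le_mn : m n / (m <= n)%N.
  by move=> W; have [/W//|/ltnW/W H lt1 lt2] := leqP m n; rewrite H.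
move=> lt_m _; elim: n le_mn => [|n IH]; first by rewrite leqn0 => /eqP ->.
rewrite leq_eqVlt ltnS => /predU1P[-> //|le_mn] /=.
rewrite nth_cat IH //; case: ltnP => // le_ni; exfalso.
have : (size (stage m) <= size (stage n))%N.
  elim: n le_mn {IH le_ni} => [|n IH]; first by rewrite leqn0 => /eqP ->.
  rewrite leq_eqVlt ltnS => /predU1P[-> //|/IH le] /=.
  by rewrite size_cat (leq_trans le) // leq_addr.
by lia.
Qed.

Lemma stage_genE n i : (i < size (stage n))%N -> stage_gen i = nth 0%R (stage n) i.
Proof. by apply: stage_prefix; apply: size_stage. Qed.

Lemma procedure_exists : exists (w : nat -> freealg K 'I_2) (k : nat -> nat)
  (om : nat -> seq (seq nat)), procedure w k om.
Proof.
exists stage_gen, (fun n => size (stage n.-1)).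
exists (fun n => stage_products (stage n.-1) n).
have gen_prodE n s : all (fun i => i < size (stage n))%N s ->
    gen_prod stage_gen s = gen_prod (nth 0%R (stage n)) s.
  by move=> /allP s_n; apply: eq_gen_prod => i /s_n/stage_genE.
split.
- exact: bracket1.
- by [].
- by move=> n _; apply: undup_uniq.
- move=> [//|n] _ s /=; rewrite mem_undup mem_filter mem_words_upto -!andbA.
  congr (_ && _); have [s_n|] := boolP (all _ s); last by rewrite !andbF.
  rewrite (gen_prodE _ _ s_n) andbT /=; apply: andb_idr => /eqP deg_s.
  by have := stage_degree s_n; rewrite deg_s leq_mul2l.
- move=> [//|n] _ j /= lt_j.
  rewrite (@stage_genE n.+1) /=; last by rewrite size_cat size_map ltn_add2l.
  rewrite nth_cat ltnNge leq_addr /= addKn (nth_map [::] _ _ lt_j) (gen_prodE n).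
    exact: erefl.
  by move: (mem_nth [::] lt_j); rewrite mem_undup mem_filter mem_words_upto => /and3P[].
- by move=> [//|n] _ /=; rewrite size_cat size_map.
Qed.

End Existence.

Theorem mainTheorem5 (K : fieldType) (charK : [pchar K] =i pred0) :
  (exists (w : nat -> freealg K 'I_2) (k : nat -> nat)
          (om : nat -> seq (seq nat)), procedure w k om) /\
  (forall (w : nat -> freealg K 'I_2) (k : nat -> nat)
          (om : nat -> seq (seq nat)), procedure w k om ->
    [/\ forall n, (1 <= n)%N -> forall i, (i < k n)%N = (ncdeg (w i) <= 2 * n)%N,
        forall n, (1 <= n)%N -> size (om n) = catalan n.+1
      & complete_set_of_free_generators w (@SL2_invariant K)]).
Proof.
split=> [|w k om proc].
  exact: procedure_exists.
split; last exact: procedure_free_generators proc.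
- move=> [//|n] _ i; have [e _ [_ lead_i]] := lead_gen proc i.
  by rewrite (lt_k_size proc) (lead_ncdeg lead_i).
- by move=> [//|n] _; apply: (size_om proc).
Qed.
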